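(* Let $T$ be a tree of order $n\geq 2$ with $\ell\le n-2$ leaves and with stem $S$. Then $$M_T\le n-\frac{1}{2^\ell}\,(n-M_S).$$
   Context: The order of a graph is its number of vertices. A subtree of a tree $T$ is a nonempty connected subgraph. The mean subtree order $M_T$ is the average of the orders of all subtrees of $T$. For a tree $T$ of order $n\ge 2$, the stem of $T$ is the tree obtained from $T$ by deleting all leaf vertices. *)

(* Defs.v *)
From mathcomp Require Import all_boot all_order all_algebra.

Set Implicit Arguments.
Unset Strict Implicit.
Unset Printing Implicit Defensive.

Import GRing.Theory Num.Theory.
Local Open Scope ring_scope.

Record sgraph := SGraph {
  vertex :> finType;
  edge : rel vertex;
  edge_sym : symmetric edge;
  edge_irrefl : irreflexive edge
}.

Section Graph.
Variable G : sgraph.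
Implicit Types (x y : G) (s : seq G) (H : {set G} * {set {set G}}).

Definition connected_graph : Prop :=
  (0 < #|G|)%N /\ forall x y, connect (@edge G) x y.

(* A cycle is a cyclic sequence of at least three distinct vertices, so that
   [:: x; y], which satisfies [ucycle] for an edge xy, is not one. *)
Definition acyclic : Prop := forall s, ucycle (@edge G) s -> (size s < 3)%N.

Definition is_tree : Prop := connected_graph /\ acyclic.

Definition leaves : {set G} := [set x | #|[set y | edge x y]| == 1%N].

Definition edge_set : {set {set G}} :=
  [set [set p.1; p.2] | p : G * G & edge p.1 p.2].

(* A subgraph is a pair H = (V(H), E(H)) with edges as two-element vertex sets;
   it need not be induced. *)
Definition is_subgraph H : bool :=
  (H.2 \subset edge_set) && [forall f in H.2, f \subset H.1].

Definition nonempty_connected H : bool :=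
  (H.1 != set0) &&
  [forall x in H.1, forall y in H.1,
     connect [rel u v | [set u; v] \in H.2] x y].

Definition subtrees : {set {set G} * {set {set G}}} :=
  [set H | is_subgraph H && nonempty_connected H].

Definition mean_subtree_order : rat :=
  (\sum_(H in subtrees) #|H.1|)%N%:R / #|subtrees|%:R.

Section Induced.
Variable A : {set G}.

Definition induced_edge : rel {x : G | x \in A} :=
  fun u v => edge (val u) (val v).

Lemma induced_edge_sym : symmetric induced_edge.
Proof. by move=> u v; apply: edge_sym. Qed.

Lemma induced_edge_irrefl : irreflexive induced_edge.
Proof. by move=> u; apply: edge_irrefl. Qed.

Definition induced : sgraph := SGraph induced_edge_sym induced_edge_irrefl.

End Induced.

Definition stem : sgraph := induced (~: leaves).

End Graph.

(* Main.v *)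
Require Import Defs.
From mathcomp Require Import all_boot all_order all_algebra.
From mathcomp Require Import zify.

Set Implicit Arguments.
Unset Strict Implicit.
Unset Printing Implicit Defensive.

Import GRing.Theory Num.Theory.
Local Open Scope ring_scope.

(** Call [n - |H|] the deficiency of a subtree [H].  The claim says that the
    mean deficiency of the subtrees of [T] is at least [1 / 2 ^ l] times the
    mean deficiency, still relative to [n], of the subtrees of the stem [S].
    Let [D_T], [D_S] be the total deficiencies and [N_T], [N_S] the numbers of
    subtrees.

    The subtrees of [S] and the [l] one-leaf subtrees are distinct subtrees of
    [T], and each of the latter has deficiency [n - 1]; hence
    [D_T >= D_S + l (n - 1)] ([stem_deficiency]).

    Conversely, a subtree of [T] other than a single leaf meets [S] in a
    subtree of [S], and it is determined by this subtree together with the set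
    of its leaves of [T], because each such leaf hangs from [S] by its only
    edge; hence [N_T <= l + 2 ^ l N_S] ([card_subtrees_le]).

    Finally every subtree has a vertex, so [D_S <= (n - 1) N_S].  Altogether
    [D_S N_T <= l D_S + 2 ^ l N_S D_S <= 2 ^ l N_S (l (n - 1) + D_S)
    <= 2 ^ l N_S D_T]. *)

(** * Reachability *)

Lemma connect_homo (T U : finType) (e : rel T) (e' : rel U) (h : T -> U) :
    (forall x y, e x y -> e' (h x) (h y)) ->
  forall x y, connect e x y -> connect e' (h x) (h y).
Proof.
move=> he x y /connectP[p + ->] {y}; elim: p x => [|z p IHp] x //=.
by case/andP=> /he exz /IHp; apply: connect_trans (connect1 exz).
Qed.

Lemma connect_step (T : finType) (e : rel T) x y :
  connect e x y -> x != y -> exists z, e x z.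
Proof.
by case/connectP=> -[|z p] /= => [_ -> /eqP//|/andP[exz _] _ _]; exists z.
Qed.

(** * Edges and subtrees *)

Lemma in_edge_set (G : sgraph) (x y : G) :
  ([set x; y] \in edge_set G) = edge x y.
Proof.
apply/imsetP/idP => [[[u v]] /= | exy]; last by exists (x, y); rewrite ?inE.
rewrite inE /= => euv eq_xy.
have u'v : v != u by apply: contraTneq euv => ->; rewrite edge_irrefl.
have: u \in [set x; y] by rewrite eq_xy set21.
have: v \in [set x; y] by rewrite eq_xy set22.
by rewrite !inE => /pred2P[] vE /pred2P[] uE; move: u'v euv;
  rewrite uE vE ?eqxx // edge_sym.
Qed.

Lemma edge_setP (G : sgraph) (f : {set G}) :
  reflect (exists x y, f = [set x; y] /\ edge x y) (f \in edge_set G).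
Proof.
apply: (iffP imsetP) => [[[x y]] /=|[x [y [-> exy]]]].
  by rewrite inE => exy ->; exists x, y.
by exists (x, y); rewrite ?inE.
Qed.

Section Subtrees.
Variable G : sgraph.
Implicit Types (x y : G) (H : {set G} * {set {set G}}).

Lemma subtreesP H :
  reflect [/\ {subset H.2 <= edge_set G},
              forall f, f \in H.2 -> f \subset H.1,
              exists x, x \in H.1
            & {in H.1 &, forall x y,
                 connect [rel u v | [set u; v] \in H.2] x y}]
          (H \in subtrees G).
Proof.
rewrite inE; apply: (iffP andP) => [[/andP[/subsetP sE /forall_inP sV]]|].
  case/andP=> /set0Pn neH /forall_inP cH; split=> // x y xH yH.
  by have /forall_inP := cH x xH; apply.
case=> sE sV neH cH; split; apply/andP; split.
- exact/subsetP.
- exact/forall_inP.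
- exact/set0Pn.
- by apply/forall_inP=> x xH; apply/forall_inP=> y yH; apply: cH.
Qed.

Lemma subtree_edge H x y :
  H \in subtrees G -> [set x; y] \in H.2 -> edge x y.
Proof. by case/subtreesP=> sE _ _ _ /sE; rewrite in_edge_set. Qed.

Lemma subtree_edge_in H x y :
  H \in subtrees G -> [set x; y] \in H.2 -> (x \in H.1) /\ (y \in H.1).
Proof.
by case/subtreesP=> _ sV _ _ /sV/subsetP sf; rewrite !sf ?set21 ?set22.
Qed.

Lemma subtree_order_gt0 H : H \in subtrees G -> (0 < #|H.1|)%N.
Proof. by case/subtreesP=> _ _ [x xH] _; apply/card_gt0P; exists x. Qed.

Lemma subtree1 x : ([set x], set0) \in subtrees G.
Proof.
apply/subtreesP; split=> /= [f|f||u v]; rewrite ?inE //.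
  by exists x; rewrite set11.
by move=> /eqP-> /eqP->; apply: connect0.
Qed.

Lemma subtree_set1 H x : H \in subtrees G -> H.1 = [set x] -> H = ([set x], set0).
Proof.
move=> sH; case: H sH => V E sH /= V1; rewrite {}V1 in sH *.
congr (_, _); apply/setP=> f; rewrite [RHS]inE; apply/negP=> fE.
have [sE _ _ _] := subtreesP _ sH; have /edge_setP[u [v [fuv euv]]] := sE f fE.
have uv : u = v.
  by rewrite fuv in fE; have [/set1P-> /set1P->] := subtree_edge_in sH fE.
by rewrite uv edge_irrefl in euv.
Qed.

Lemma card_subtrees_gt0 : (0 < #|G|)%N -> (0 < #|subtrees G|)%N.
Proof.
by case/card_gt0P=> x _; apply/card_gt0P; exists ([set x], set0); apply: subtree1.
Qed.

(** The reference order [n] need not be that of [G], so that this also applies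
    to the stem measured against the order of the whole tree. *)
Lemma mean_deficiency (n : nat) : (0 < #|G|)%N -> (#|G| <= n)%N ->
  n%:R - mean_subtree_order G =
    (\sum_(H in subtrees G) (n - #|H.1|))%N%:R / #|subtrees G|%:R.
Proof.
move=> /card_subtrees_gt0 N_gt0 le_n.
have N_neq0 : #|subtrees G|%:R != 0 :> rat by rewrite pnatr_eq0 -lt0n.
rewrite /mean_subtree_order -[n%:R](mulfK N_neq0) -mulrBl; congr (_ / _).
apply/eqP; rewrite subr_eq -natrM -natrD eqr_nat -big_split /=.
rewrite mulnC -sum_nat_const; apply/eqP/eq_bigr => H _.
by rewrite subnK // (leq_trans (max_card _)).
Qed.

End Subtrees.

(** * Subtrees of an induced subgraph *)

Section Inclusion.
Variables (G : sgraph) (A : {set G}).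
Implicit Types (K : {set induced A} * {set {set induced A}}).

Definition incl (x : induced A) : G := sval x.

Definition incl_subgraph K : {set G} * {set {set G}} :=
  (incl @: K.1, (fun f : {set induced A} => incl @: f) @: K.2).

Definition restrict_subgraph (H : {set G} * {set {set G}}) :
    {set induced A} * {set {set induced A}} :=
  (incl @^-1: H.1, [set f : {set induced A} | incl @: f \in H.2]).

Lemma incl_inj : injective incl. Proof. exact: val_inj. Qed.

Lemma incl_in x : incl x \in A. Proof. exact: valP x. Qed.

Lemma inclP (x : G) : x \in A -> exists y, incl y = x.
Proof. by move=> xA; exists (exist _ x xA). Qed.

Lemma incl_set2 x y : incl @: [set x; y] = [set incl x; incl y].
Proof. by rewrite imsetU1 imset_set1. Qed.

Lemma incl_subgraph_inj : injective incl_subgraph.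
Proof.
case=> V E [V' E'] [] /(imset_inj incl_inj)-> /imset_inj-> //.
exact/imset_inj/incl_inj.
Qed.

Lemma incl_subtree K : K \in subtrees (induced A) -> incl_subgraph K \in subtrees G.
Proof.
case/subtreesP=> sE sV [x xK] cK; apply/subtreesP; split=> /=.
- move=> _ /imsetP[f /sE/edge_setP[u [v [-> euv]]] ->].
  by rewrite incl_set2 in_edge_set.
- by move=> _ /imsetP[f /sV sf ->]; apply: imsetS.
- by exists (incl x); apply: imset_f.
move=> _ _ /imsetP[u uK ->] /imsetP[v vK ->].
apply: connect_homo (cK u v uK vK) => a b /= abK.
by rewrite -incl_set2 imset_f.
Qed.

End Inclusion.

(** * Leaves *)

Section Leaves.
Variable T : sgraph.
Implicit Types (x y z v : T) (H : {set T} * {set {set T}}).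

Lemma leaf_nbr_uniq v x y : v \in leaves T -> edge v x -> edge v y -> x = y.
Proof.
rewrite inE => /cards1P[z nbr_v] vx vy.
have: x \in [set w | edge v w] by rewrite inE.
have: y \in [set w | edge v w] by rewrite inE.
by rewrite nbr_v => /set1P-> /set1P->.
Qed.

(** Two adjacent leaves form a whole component. *)
Lemma adjacent_leaves x y : connected_graph T ->
  x \in leaves T -> y \in leaves T -> edge x y -> forall z, z \in leaves T.
Proof.
move=> [_ cT] xL yL exy z.
have cl : closed (@edge T) (pred2 x y).
  apply: (intro_closed (sym_connect_sym (@edge_sym T))) => u v euv /=.
  rewrite !inE => /orP[]/eqP uE; rewrite uE in euv.
    by rewrite (leaf_nbr_uniq xL euv exy) eqxx orbT.
  by rewrite edge_sym in exy; rewrite (leaf_nbr_uniq yL euv exy) eqxx.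
have /esym := closed_connect cl (cT x z).
by rewrite [x \in _]inE /= eqxx => /pred2P[]->.
Qed.

Definition leaf_subtrees : {set {set T} * {set {set T}}} :=
  [set ([set x], set0) | x in leaves T].

Lemma card_leaf_subtrees : #|leaf_subtrees| = #|leaves T|.
Proof. by apply: card_imset => x y [] /set1_inj. Qed.

Lemma leaf_subtrees_sub : leaf_subtrees \subset subtrees T.
Proof. by apply/subsetP=> _ /imsetP[x _ ->]; apply: subtree1. Qed.

(** A subtree that avoids the stem and is not a single leaf would contain two
    adjacent leaves, and by connectedness [T] would have no other vertex. *)
Lemma subtree_meets_stem H : connected_graph T -> leaves T != setT ->
  H \in subtrees T :\: leaf_subtrees -> exists2 x, x \in H.1 & x \notin leaves T.
Proof.
move=> cT; rewrite -subTset => /subsetPn[s _ sNL] /setDP[sH HNleaf].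
have [sub|/subsetPn//] := boolP (H.1 \subset leaves T).
have [_ _ [x xH] cH] := subtreesP _ sH; have xL := subsetP sub x xH.
have [sub1|/subsetPn[y yH]] := boolP (H.1 \subset [set x]).
  case/imsetP: HNleaf; exists x => //; apply: subtree_set1 => //.
  by apply/eqP; rewrite eqEsubset sub1 sub1set.
rewrite inE eq_sym => /(connect_step (cH x y xH yH))[z /= xzH].
have [_ zH] := subtree_edge_in sH xzH.
have := adjacent_leaves cT xL (subsetP sub z zH) (subtree_edge sH xzH) s.
by rewrite (negPf sNL).
Qed.

(** A leaf of [T] in the subtree must be joined to the vertex [y] inside the
    subtree, and this can only begin with its unique edge. *)
Lemma leaf_edge_in_subtree H v x y : H \in subtrees T ->
    y \in H.1 -> y \notin leaves T ->
  v \in H.1 -> v \in leaves T -> edge v x -> [set v; x] \in H.2.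
Proof.
move=> sH yH yNL vH vL evx; have [_ _ _ cH] := subtreesP _ sH.
have v'y : v != y by apply: contraNneq yNL => <-.
have [z /= vzH] := connect_step (cH v y vH yH) v'y.
by rewrite (leaf_nbr_uniq vL evx (subtree_edge sH vzH)).
Qed.

(** A walk that enters a leaf must leave it along the same edge, so detours
    through leaves can be cut out. *)
Lemma connect_avoiding_leaves (e : rel T) (x y : stem T) :
    (forall u v, e u v -> edge u v) ->
  connect e (incl x) (incl y) -> connect (relpre (@incl T _) e) x y.
Proof.
move=> e_edge /connectP[p]; have [n] := ubnP (size p).
elim: n => // n IHn in x p *; case: p => [|v p] /= le_pn.
  by move=> _ /incl_inj->; apply: connect0.
case/andP=> exv ep y_last.
have [vL|vNL] := boolP (v \in leaves T); last first.
  have /inclP[w wv] : v \in ~: leaves T by rewrite inE.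
  rewrite -{v vNL}wv in exv ep y_last.
  by apply: connect_trans (connect1 exv) (IHn w p _ ep y_last).
case: p => [|w p] /= in le_pn ep y_last *.
  by have := incl_in y; rewrite inE y_last vL.
case/andP: ep => evw ep; have exv' := e_edge _ _ exv.
rewrite edge_sym in exv'; have wx := leaf_nbr_uniq vL (e_edge _ _ evw) exv'.
rewrite {w evw}wx in ep y_last; apply: IHn ep y_last.
by apply: ltn_trans (ltnSn _) _.
Qed.

Lemma restrict_subtree H x : H \in subtrees T -> x \in H.1 -> x \notin leaves T ->
  restrict_subgraph (~: leaves T) H \in subtrees (stem T).
Proof.
move=> sH xH xNL; have [sE sV _ cH] := subtreesP _ sH.
apply/subtreesP; split.
- move=> f; rewrite inE => fH; have /edge_setP[u [v [fuv euv]]] := sE _ fH.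
  have uf : u \in @incl T (~: leaves T) @: f by rewrite fuv set21.
  have vf : v \in @incl T (~: leaves T) @: f by rewrite fuv set22.
  case/imsetP: uf => u' _ uE; case/imsetP: vf => v' _ vE; subst u v.
  rewrite -incl_set2 in fuv; have -> := imset_inj (@incl_inj _ _) fuv.
  by rewrite in_edge_set.
- move=> f; rewrite inE => /sV/subsetP sf; apply/subsetP=> u uf.
  by rewrite inE sf ?imset_f.
- have /inclP[y yx] : x \in ~: leaves T by rewrite inE.
  by exists y; rewrite inE yx.
move=> u v; rewrite !inE => uH vH.
have := connect_avoiding_leaves (fun _ _ => subtree_edge sH) (cH _ _ uH vH).
by apply: connect_sub => a b /= ab; apply: connect1; rewrite /= inE incl_set2.
Qed.

(** The code of a subtree.  Its edges at leaves are not recorded: as soon as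
    the subtree has a vertex in the stem they are forced, by
    [leaf_edge_in_subtree]. *)
Definition stem_and_leaves H :=
  (restrict_subgraph (~: leaves T) H, H.1 :&: leaves T).

Lemma stem_and_leaves_inj : connected_graph T -> leaves T != setT ->
  {in subtrees T :\: leaf_subtrees &, injective stem_and_leaves}.
Proof.
move=> cT LNT H K bH bK [eqV eqE eqL].
have eq1 : H.1 = K.1.
  apply/setP=> x; have [xL|xNL] := boolP (x \in leaves T).
    by move/setP/(_ x): eqL; rewrite !in_setI xL !andbT.
  have /inclP[y <-] : x \in ~: leaves T by rewrite inE.
  by move/setP/(_ y): eqV; rewrite !inE.
suff sub2 H' K' : H' \in subtrees T :\: leaf_subtrees ->
    K' \in subtrees T :\: leaf_subtrees -> H'.1 = K'.1 ->
    (restrict_subgraph (~: leaves T) H').2 = (restrict_subgraph (~: leaves T) K').2 ->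
    H'.2 \subset K'.2.
  rewrite [H]surjective_pairing [K]surjective_pairing eq1; congr (_, _).
  by apply/eqP; rewrite eqEsubset !sub2.
move=> {eqV eqE eqL eq1 H K} bH {}bK eqV /= eqE.
have [y yK yNL] := subtree_meets_stem cT LNT bK.
have /setDP[sH _] := bH; have /setDP[sK _] := bK.
have [sE sV _ _] := subtreesP _ sH.
apply/subsetP=> f fH; have /edge_setP[u [v [fuv euv]]] := sE f fH.
rewrite fuv in fH *; have [] := subtree_edge_in sH fH; rewrite eqV => uK vK.
have [uL|uNL] := boolP (u \in leaves T).
  exact: leaf_edge_in_subtree sK yK yNL uK uL euv.
have [vL|vNL] := boolP (v \in leaves T).
  by rewrite setUC; apply: (leaf_edge_in_subtree sK yK); rewrite // edge_sym.
have /inclP[u' u'E] : u \in ~: leaves T by rewrite inE.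
have /inclP[v' v'E] : v \in ~: leaves T by rewrite inE.
move/setP/(_ [set u'; v']): eqE; rewrite !inE incl_set2 u'E v'E fH.
by move=> /esym.
Qed.

Lemma card_subtrees_le : connected_graph T -> leaves T != setT ->
  (#|subtrees T| <= #|leaves T| + 2 ^ #|leaves T| * #|subtrees (stem T)|)%N.
Proof.
move=> cT LNT; rewrite -(cardsID leaf_subtrees).
rewrite (setIidPr leaf_subtrees_sub) card_leaf_subtrees leq_add2l.
(* The subtrees other than single leaves are counted by their codes. *)
rewrite -(card_in_imset (stem_and_leaves_inj cT LNT)).
rewrite mulnC -card_powerset -cardsX; apply/subset_leq_card/subsetP.
move=> _ /imsetP[H bH ->]; have [x xH xNL] := subtree_meets_stem cT LNT bH.
case/setDP: bH => sH _.
by rewrite in_setX powersetE subsetIr andbT (restrict_subtree sH xH xNL).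
Qed.

(** The subtrees of the stem and the single leaves are distinct subtrees of
    [T]; the deficiencies of all other subtrees are only bounded below by 0. *)
Lemma stem_deficiency n :
  (\sum_(H in subtrees (stem T)) (n - #|H.1|) + #|leaves T| * (n - 1)
     <= \sum_(H in subtrees T) (n - #|H.1|))%N.
Proof.
rewrite (big_setID leaf_subtrees) /= (setIidPr leaf_subtrees_sub) addnC.
apply: leq_add.
  rewrite (eq_bigr (fun=> n - 1)%N); last by move=> _ /imsetP[x _ ->]; rewrite cards1.
  by rewrite sum_nat_const card_leaf_subtrees.
have incl_stem K : K \in subtrees (stem T) ->
    incl_subgraph K \in subtrees T :\: leaf_subtrees.
  move=> sK; rewrite in_setD incl_subtree // andbT.
  apply/imsetP=> -[x xL [KV _]]; have : x \in [set x] by rewrite set11.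
  by rewrite -KV => /imsetP[y _ xy]; have := incl_in y; rewrite -xy inE xL.
pose F H := (n - #|H.1|)%N.
rewrite (eq_bigr (fun K => F (incl_subgraph K))); last first.
  by move=> K _; rewrite /F card_imset //; apply: incl_inj.
rewrite -(big_imset F) /=; last by move=> ? ? _ _; apply: incl_subgraph_inj.
rewrite [leqRHS](big_setID (@incl_subgraph T (~: leaves T) @: subtrees (stem T))) /=.
rewrite (setIidPr _) ?leq_addr //.
by apply/subsetP=> _ /imsetP[K /incl_stem ? ->].
Qed.

End Leaves.

Theorem theorem6p3 (T : sgraph) (n l : nat)
    (treeT : is_tree T) (orderT : #|T| = n) (n_ge2 : (2 <= n)%N)
    (leavesT : #|leaves T| = l) (l_le : (l <= n - 2)%N) :
  mean_subtree_order T
    <= n%:R - 1 / 2%:R ^+ l * (n%:R - mean_subtree_order (stem T)).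
Proof.
have cT : connected_graph T by case: treeT.
have cardS : #|stem T| = (n - l)%N.
  by rewrite /= card_sig -leavesT -orderT -(cardsC (leaves T)) addKn; apply: eq_card.
have LNT : leaves T != setT.
  by apply: contraTneq l_le => LT; rewrite -leavesT LT cardsT orderT; lia.
have T_gt0 : (0 < #|T|)%N by lia.
have S_gt0 : (0 < #|stem T|)%N by lia.
have NT := card_subtrees_le cT LNT; have DT := stem_deficiency T n.
have NT_gt0 := card_subtrees_gt0 T_gt0; have NS_gt0 := card_subtrees_gt0 S_gt0.
have DS : (\sum_(H in subtrees (stem T)) (n - #|H.1|)
            <= #|subtrees (stem T)| * (n - 1))%N.
  rewrite -sum_nat_const; apply: leq_sum => H sH.
  by rewrite leq_sub2l // subtree_order_gt0.
rewrite lerBrDr -lerBrDl mean_deficiency ?orderT //; last by lia.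
rewrite [leRHS]mean_deficiency ?orderT //; last by lia.
rewrite leavesT in NT DT.
move: NT DT NT_gt0 NS_gt0 DS.
set NT := #|subtrees T|; set NS := #|subtrees (stem T)|.
set DT := (\sum_(H in subtrees T) _)%N; set DS := (\sum_(H in _) _)%N.
move=> leNT leDT NT_gt0 NS_gt0 leDS.
have pow_gt0 : (0 < 2 ^ l)%N by rewrite expn_gt0.
rewrite mul1r mulrC -mulrA -invfM -natrX -natrM.
rewrite ler_pdivrMr ?ltr0n ?muln_gt0 ?NS_gt0 ?pow_gt0 // mulrAC ler_pdivlMr ?ltr0n //.
rewrite -!natrM ler_nat.
apply: leq_trans (leq_mul (leqnn DS) leNT) _.
apply: leq_trans (leq_mul leDT (leqnn _)).
rewrite mulnDr mulnDl addnC (mulnC (2 ^ l)%N) leq_add2l.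
rewrite mulnC -mulnA leq_mul2l (leq_trans leDS) ?orbT //.
by rewrite mulnA (mulnC NS) leq_pmulr.
Qed.
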